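(* Consider a constrained Markov decision process (CMDP) as described in the context, and let $\varepsilon \in (0,1)$. Run the inexact augmented Lagrangian algorithm described in the context with dual initialization $\lambda_1 = 0$, an arbitrary penalty parameter $\beta > 0$, subproblem accuracies $\epsilon_t = \mathcal{O}(1/t^2)$, and $T = \mathcal{O}(1/\varepsilon^2)$ outer iterations. Suppose that for every $t \ge 1$ an oracle is available which returns a policy $\pi_{t+1}$ satisfying $$\mathcal{L}^\beta(\pi_{t+1}, \lambda_t) \;\ge\; \max_{\pi} \mathcal{L}^\beta(\pi, \lambda_t) - \epsilon_t .$$ Then the returned (single, stationary, stochastic) policy $\pi_{T+1}$ is an $\varepsilon$-approximate solution of the CMDP, i.e. $$V^{\pi_{T+1}}_r(\rho) \ge V^*_r(\rho) - \varepsilon \quad\text{and}\quad V^{\pi_{T+1}}_{c_i}(\rho) \ge b_i - \varepsilon \ \text{ for all } i \in [m].$$ (The $\mathcal{O}(\cdot)$ notation hides constants independent of $t$ and $\varepsilon$.)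
   Context: CMDP: finite state space $\mathcal{S}$ and finite action space $\mathcal{A}$; transition kernel $\mathcal{P}(\cdot\mid s,a)$; initial distribution $\rho$ on $\mathcal{S}$; discount factor $\gamma \in [0,1)$; reward $r:\mathcal{S}\times\mathcal{A}\to[0,1]$; constraint rewards $c_1,\dots,c_m:\mathcal{S}\times\mathcal{A}\to[0,1]$; thresholds $b_1,\dots,b_m \ge 0$. A policy $\pi$ assigns to every state $s$ a probability distribution $\pi(\cdot\mid s)$ on $\mathcal{A}$. For a bounded $u:\mathcal{S}\times\mathcal{A}\to\mathbb{R}$, $Q^\pi_u(s,a) = \mathbb{E}[\sum_{\tau\ge 0}\gamma^\tau u(s_\tau,a_\tau)\mid s_0=s,a_0=a]$ with $s_{\tau+1}\sim\mathcal{P}(\cdot\mid s_\tau,a_\tau)$, $a_{\tau+1}\sim \pi(\cdot\mid s_{\tau+1})$; $V^\pi_u(s)=\sum_a \pi(a\mid s)Q^\pi_u(s,a)$ and $V^\pi_u(\rho)=\sum_s\rho(s)V^\pi_u(s)$. The CMDP problem is $\max_\pi V^\pi_r(\rho)$ subject to $V^\pi_{c_i}(\rho)\ge b_i$ for all $i\in[m]$; $V^*_r(\rho)$ denotes its optimal value. Augmented Lagrangian: for $\beta>0$ and $\lambda\in\mathbb{R}^m$, $$\mathcal{L}^\beta(\pi,\lambda) = V^\pi_r(\rho) + \frac{\beta}{2}\sum_{i=1}^m\Big(-\min\Big\{V^\pi_{c_i}(\rho)-b_i-\frac{\lambda_i}{\beta},0\Big\}^2 + \frac{\lambda_i^2}{\beta^2}\Big).$$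 Algorithm: start from an initial policy $\pi_1$ and $\lambda_1$; for $t=1,\dots,T$: obtain $\pi_{t+1}$ from the oracle (accuracy $\epsilon_t$ for $\mathcal{L}^\beta(\cdot,\lambda_t)$), then for each $i\in[m]$ set $\lambda_{t+1}[i] = \lambda_t[i] - \frac{\beta}{2}\big(V^{\pi_{t+1}}_{c_i}(\rho) - [b_i + \xi_i(\pi_{t+1})]\big)$, where $\xi_i(\pi) = \max\{V^\pi_{c_i}(\rho) - b_i - \lambda_t[i]/\beta,\,0\}$. Return $\pi_{T+1}$. *)

(* Defs.v *)
From HB Require Import structures.
From mathcomp Require Import all_boot all_order all_algebra.
From mathcomp Require Import classical_sets reals topology normedtype sequences.
Set Implicit Arguments. Unset Strict Implicit. Unset Printing Implicit Defensive.
Import Order.TTheory GRing.Theory Num.Theory numFieldNormedType.Exports.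
Local Open Scope ring_scope.
Local Open Scope classical_set_scope.

Section CMDP.
Variables (R : realType) (S A : finType).

Definition is_kernel (P : S -> A -> S -> R) : Prop :=
  (forall s a s', 0 <= P s a s') /\ (forall s a, \sum_(s' : S) P s a s' = 1).

Definition is_dist (rho : S -> R) : Prop :=
  (forall s, 0 <= rho s) /\ \sum_(s : S) rho s = 1.

Definition is_policy (pi : S -> A -> R) : Prop :=
  (forall s a, 0 <= pi s a) /\ (forall s, \sum_(a : A) pi s a = 1).

(* law of (s_tau, a_tau) given s_0 = s, a_0 = a under pi *)
Fixpoint occ (P : S -> A -> S -> R) (pi : S -> A -> R) (s : S) (a : A)
    (tau : nat) : S -> A -> R :=
  match tau with
  | 0 => fun s' a' => if (s' == s) && (a' == a) then 1 else 0
  | n.+1 => fun s' a' =>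
      \sum_(s'' : S) \sum_(a'' : A) occ P pi s a n s'' a'' * P s'' a'' s' * pi s' a'
  end.

Definition Qfun (P : S -> A -> S -> R) (gamma : R) (pi : S -> A -> R)
    (u : S -> A -> R) (s : S) (a : A) : R :=
  limn (fun n : nat => \sum_(0 <= tau < n)
     (gamma ^+ tau * \sum_(s' : S) \sum_(a' : A) occ P pi s a tau s' a' * u s' a')).

Definition Vfun P gamma pi u (s : S) : R :=
  \sum_(a : A) pi s a * Qfun P gamma pi u s a.

Definition Vrho P (rho : S -> R) gamma pi u : R :=
  \sum_(s : S) rho s * Vfun P gamma pi u s.

Definition feasible P rho gamma (m : nat) (c : 'I_m -> S -> A -> R)
    (b : 'I_m -> R) (pi : S -> A -> R) : Prop :=
  forall i, b i <= Vrho P rho gamma pi (c i).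

Definition Vstar P rho gamma r m c b : R :=
  sup [set x | exists pi, is_policy pi /\ feasible P rho gamma (m:=m) c b pi /\
                          x = Vrho P rho gamma pi r].

Definition augL P rho gamma r (m : nat) (c : 'I_m -> S -> A -> R) (b : 'I_m -> R)
    (beta : R) (pi : S -> A -> R) (lam : 'I_m -> R) : R :=
  Vrho P rho gamma pi r +
  beta / 2 * \sum_(i < m)
     (- (Num.min (Vrho P rho gamma pi (c i) - b i - lam i / beta) 0) ^+ 2
      + lam i ^+ 2 / beta ^+ 2).

Definition augL_max P rho gamma r m c b beta (lam : 'I_m -> R) : R :=
  sup [set x | exists pi, is_policy pi /\ x = augL P rho gamma r c b beta pi lam].

Definition xi P rho gamma (m : nat) (c : 'I_m -> S -> A -> R) (b : 'I_m -> R)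
    (beta : R) (lam : 'I_m -> R) (pi : S -> A -> R) (i : 'I_m) : R :=
  Num.max (Vrho P rho gamma pi (c i) - b i - lam i / beta) 0.

End CMDP.

(* Main.v *)
Require Import Defs.
From HB Require Import structures.
From mathcomp Require Import all_boot all_order all_algebra.
From mathcomp Require Import classical_sets reals topology normedtype sequences.
From mathcomp Require Import boolp function_spaces ring lra.
Import Order.TTheory GRing.Theory Num.Theory numFieldNormedType.Exports.
Local Open Scope ring_scope.

(**
In terms of the slacks [w i = min (V_(c i) - b i) (lam i / beta)] the augmented
Lagrangian is [V_r + \sum_i (lam i * w i - beta / 2 * w i ^+ 2)] and the dual
update is [lam' = lam - beta / 2 * w]. Values of stationary policies are linear
functionals of occupancy measures, which form a polytope; hence the attainable
values are convex, and Farkas' lemma yields multipliers [mu] without a Slater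
condition. Let [d t] be the augmented Lagrangian at step [t] minus the optimal
value. The multipliers give
[d t <= \sum_i (lam i - mu i) * w i - beta / 2 * \sum_i w i ^+ 2], so that the
squared distance from [lam] to [mu] grows by at most [beta * eps_t] per step and
stays bounded. Convexity gives
[d t.+1 <= d t + 2 * eps_t - beta / 4 * \sum_i w i ^+ 2], hence a recursion
[d t.+1 <= d t - kappa * d t ^+ 2 + O(1 / t ^ 2)] and [d t = O(1 / t)]. Finally
[\sum_i w i ^+ 2 = O(1 / T)] at the last iterate, which bounds both the constraint
violation and the suboptimality by [O(1 / sqrt T)].
*)

Set Implicit Arguments.
Unset Strict Implicit.

(** * Farkas' lemma over finite index types *)

(* Bartl's induction: eliminate one constraint by projecting along a vector that
   violates only this constraint. *)
Lemma farkas_ord (R : realFieldType) (T : finType) (m : nat)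
    (a : 'I_m -> T -> R) (g : T -> R) :
  (forall x : T -> R, (forall j, \sum_t a j t * x t <= 0) ->
     \sum_t g t * x t <= 0) ->
  exists u : 'I_m -> R,
    (forall j, 0 <= u j) /\ (forall t, g t = \sum_j u j * a j t).
Proof.
elim: m a g => [|m IH] a g H.
  exists (fun=> 0); split => // t; rewrite big_ord0.
  have /H : forall j : 'I_0, \sum_t a j t * g t <= 0 by case.
  have sq0 : forall t, true -> 0 <= g t * g t by move=> ? _; rewrite -expr2 sqr_ge0.
  move=> le0; have /eqP : \sum_t g t * g t = 0.
    by apply/le_anti; rewrite le0 sumr_ge0.
  by rewrite psumr_eq0// => /allP /(_ t (mem_index_enum _)); rewrite mulf_eq0 orbb => /eqP.
pose a0 := a ord0; pose a' j := a (lift ord0 j).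
have [H'|] := EM (forall x, (forall j, \sum_t a' j t * x t <= 0) ->
     \sum_t g t * x t <= 0).
  have [u [u0 gu]] := IH a' g H'.
  exists (fun j => if unlift ord0 j is Some k then u k else 0); split.
    by move=> j; case: unliftP.
  move=> t; rewrite big_ord_recl unlift_none mul0r add0r gu.
  by apply: eq_bigr => j _; rewrite liftK.
move=> /existsNP [y /not_implyP [ay /negP]]; rewrite -ltNge => gy.
have a0y : 0 < \sum_t a0 t * y t.
  rewrite ltNge; apply/negP => a0y; move: gy; rewrite ltNge H// => j.
  by case: (unliftP ord0 j) => [k ->|->//]; exact: ay.
(* [x0] is scaled so that [a0] takes the value 1 on it. By [prE], [pr b] at [x] is [b] at the
   projection of [x] onto the kernel of [a0] along [x0]. *)
pose x0 t := y t / \sum_t a0 t * y t.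
pose d (b : T -> R) := \sum_t b t * x0 t.
have dE b : d b = (\sum_t b t * y t) / \sum_t a0 t * y t.
  by rewrite /d mulr_suml; apply: eq_bigr => t _; rewrite mulrA.
have da0 : d a0 = 1 by rewrite dE divff// gt_eqF.
have dg : 0 < d g by rewrite dE divr_gt0.
have da' j : d (a' j) <= 0 by rewrite dE pmulr_lle0 ?invr_gt0// ay.
pose pr (b : T -> R) t := b t - d b * a0 t.
have prE b x : \sum_t pr b t * x t
    = \sum_t b t * (x t - (\sum_s a0 s * x s) * x0 t).
  rewrite (eq_bigr (fun t => b t * x t - d b * (a0 t * x t))); last first.
    by move=> t _; rewrite /pr mulrBl mulrA.
  rewrite [RHS](eq_bigr (fun t => b t * x t - (\sum_s a0 s * x s) * (b t * x0 t))); last first.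
    by move=> t _; rewrite mulrBr; congr (_ - _); rewrite mulrCA.
  by rewrite !sumrB -!mulr_sumr mulrC.
have [|u [u0 gu]] := IH (fun j => pr (a' j)) (pr g).
  move=> x ax; rewrite prE; apply: H => j.
  case: (unliftP ord0 j) => [k ->|->]; first by rewrite -prE; exact: ax.
  rewrite -/a0 -prE big1// => t _.
  by rewrite /pr da0 mul1r subrr mul0r.
(* The coefficient of [a0] collects what the projections removed; it is nonnegative because
   [d g > 0] while every [d (a' k) <= 0]. *)
exists (fun j => if unlift ord0 j is Some k then u k
                 else d g - \sum_k u k * d (a' k)); split.
  move=> j; case: unliftP => // _; rewrite subr_ge0 (le_trans _ (ltW dg))//.
  by apply: sumr_le0 => k _; rewrite mulr_ge0_le0.
move=> t; rewrite big_ord_recl unlift_none -/a0.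
rewrite [X in _ + X](eq_bigr (fun k => u k * a' k t)); last by move=> k _; rewrite liftK.
have := gu t; rewrite {1}/pr => /eqP; rewrite subr_eq => /eqP ->.
rewrite mulrBl [RHS]addrC addrA addrAC; congr (_ + _).
rewrite mulr_suml -sumrB; apply: eq_bigr => k _; rewrite /pr; ring.
Qed.

Lemma farkas (R : realFieldType) (T J : finType)
    (a : J -> T -> R) (g : T -> R) :
  (forall x : T -> R, (forall j, \sum_t a j t * x t <= 0) ->
     \sum_t g t * x t <= 0) ->
  exists u : J -> R,
    (forall j, 0 <= u j) /\ (forall t, g t = \sum_j u j * a j t).
Proof.
move=> H; have [|u [u0 gu]] := @farkas_ord _ _ _ (fun k : 'I_#|J| => a (enum_val k)) g.
  by move=> x ax; apply: H => j; rewrite -(enum_rankK j); exact: ax.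
exists (fun j => u (enum_rank j)); split=> [j|t]; first exact: u0.
rewrite gu [RHS](reindex (@enum_val _ J)) /=; last exact/onW_bij/enum_val_bij.
by apply: eq_bigr => k _; rewrite enum_valK.
Qed.

(** * Scalar inequalities and the decay recursion *)

Lemma cauchy_schwarz_sum (R : realFieldType) (I : finType) (a b : I -> R) :
  (\sum_i a i * b i) ^+ 2 <= (\sum_i a i ^+ 2) * (\sum_i b i ^+ 2).
Proof.
pose A := \sum_i a i ^+ 2; pose B := \sum_i b i ^+ 2; pose D := \sum_i a i * b i.
have A0 : 0 <= A by apply: sumr_ge0 => i _; exact: sqr_ge0.
have key s t : 0 <= s ^+ 2 * B - 2 * s * t * D + t ^+ 2 * A.
  have -> : s ^+ 2 * B - 2 * s * t * D + t ^+ 2 * A = \sum_i (s * b i - t * a i) ^+ 2.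
    rewrite !mulr_sumr -sumrB -big_split /=.
    by apply: eq_bigr => i _; ring.
  by apply: sumr_ge0 => i _; exact: sqr_ge0.
rewrite -/A -/B -/D; move: A0; rewrite le_eqVlt => /orP[/eqP A0|A0].
  have D0 : D = 0.
    have a0 i : a i = 0.
      move/esym/eqP: A0; rewrite psumr_eq0; last by move=> ? _; exact: sqr_ge0.
      by move=> /allP /(_ i (mem_index_enum _)); rewrite sqrf_eq0 => /eqP.
    by rewrite /D big1// => i _; rewrite a0 mul0r.
  by rewrite D0 -A0 mul0r expr0n.
have := key A D; rewrite (_ : _ + _ = A * (A * B - D ^+ 2)); last by ring.
by rewrite pmulr_rge0// subr_ge0.
Qed.

(** A concave parabola with peak at [lam / beta]: below [v] it is maximal at the peak truncated by
    [v]. *)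
Lemma min_slack_maximizes (R : realFieldType) (beta lam v w : R) : 0 < beta -> w <= v ->
  lam * w - beta / 2 * w ^+ 2 <=
  lam * Num.min v (lam / beta) - beta / 2 * (Num.min v (lam / beta)) ^+ 2.
Proof.
move=> b0 wv; set q := lam / beta.
have -> : lam = beta * q by rewrite /q mulrC divfK// gt_eqF.
rewrite -subr_ge0.
have -> : forall z, beta * q * z - beta / 2 * z ^+ 2 - (beta * q * w - beta / 2 * w ^+ 2)
   = beta / 2 * ((z - w) * (2 * q - z - w)) by move=> z; field.
rewrite mulr_ge0 ?divr_ge0 ?(ltW b0)//.
case: (leP v q) => vq; first by rewrite mulr_ge0; lra.
by rewrite (_ : _ * _ = (q - w) ^+ 2) ?sqr_ge0//; ring.
Qed.

(** The comparisons rest on [1/t - 1/(t+1) = 1/(t (t+1))] and let error terms [1 / t ^ 2]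
    telescope. *)
Lemma inv_succ_bounds (R : realFieldType) (t : nat) : (0 < t)%N ->
  [/\ 0 < (t.+1%:R : R)^-1, (t%:R : R)^-1 <= 1,
      (t%:R : R)^-1 - (t.+1%:R)^-1 <= ((t%:R)^-1) ^+ 2,
      ((t%:R : R)^-1) ^+ 2 <= 2 * ((t%:R)^-1 - (t.+1%:R)^-1) &
      (t%:R : R)^-1 <= 2 * (t.+1%:R)^-1].
Proof.
move=> t0; have t1 : 1 <= t%:R :> R by rewrite (ler_nat R 1 t).
rewrite -natr1; set s : R := t%:R in t1 *; set p := s^-1.
have s0 : 0 < s by lra.
have p0 : 0 < p by rewrite invr_gt0.
have sp : s * p = 1 by rewrite mulfV// gt_eqF.
have p1 : p <= 1 by rewrite invf_le1.
have q0 : 0 < (s + 1)^-1 by rewrite invr_gt0; lra.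
set q := (s + 1)^-1 in q0 *.
have pq : p - q = p * q by rewrite /p /q; field; rewrite !gt_eqF//; lra.
have qp : q <= p by rewrite -subr_ge0 pq mulr_ge0// ltW.
have pq2 : p <= 2 * q by have := ler_wpM2r (ltW q0) p1; lra.
split=> //; first by rewrite pq expr2 ler_pM2l.
by rewrite pq expr2 mulrCA ler_pM2l.
Qed.

(* The recursion is that of the differential inequality d' <= - c d^2. *)
Lemma quadratic_decay_rate (R : realFieldType) (c C K : R) (d g : nat -> R) (T : nat) :
  0 < c -> 0 <= C -> K = 2 / c + 4 * C ->
  (forall t, (1 <= t <= T)%N -> d t <= (8 * c)^-1) ->
  (forall t, (1 <= t <= T)%N -> 0 <= g t) ->
  (forall t, (1 <= t <= T)%N -> 0 <= d t -> c * d t ^+ 2 <= g t) ->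
  (forall t, (1 <= t < T)%N -> d t.+1 <= d t + 2 * (C / t%:R ^+ 2) - g t) ->
  forall t, (1 <= t <= T)%N -> d t <= K / t%:R.
Proof.
move=> c0 C0 KE dB g0 dg dS.
have cK : 2 <= c * K.
  rewrite KE mulrDr mulrCA mulfV ?gt_eqF// mulr1 lerDl.
  by rewrite !mulr_ge0// ltW.
have K0 : 0 < K by rewrite -(pmulr_rgt0 _ c0); lra.
have KC : 4 * C <= K.
  by rewrite KE lerDr divr_ge0// ltW.
have e8 : c * (8 * c)^-1 = 8^-1 by field; rewrite gt_eqF.
elim=> // t IH /andP[_ tT].
have dB' : c * d t.+1 <= 8^-1 by rewrite -e8 ler_pM2l// dB.
rewrite -(ler_pM2l c0).
case: t => [|t] in IH tT dB' *.
  by rewrite divr1; lra.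
have tT' : (1 <= t.+1 <= T)%N by rewrite (ltnW tT).
have {}IH := IH tT'.
have {}dS := dS t.+1 tT; have {}dg := dg _ tT'; have {}g0 := g0 _ tT'.
have [//|q0 p1 pq pq' p2q] := @inv_succ_bounds R t.+1.
rewrite -exprVn in dS.
set p := (t.+1%:R)^-1 in IH dS p1 pq pq' p2q.
set q := (t.+2%:R)^-1 in q0 pq pq' p2q *.
set x := d t.+1 in IH dS dg *.
have p0 : 0 < p by rewrite invr_gt0.
rewrite ler_pM2l//.
(* The quadratic decrease is available only for nonnegative [x]; for negative [x] the error term
   [2 * (C * p ^+ 2)] alone is below [K * q]. *)
have [x0|x0] := ltP x 0.
  have : 2 * (C * p ^+ 2) <= K * q.
    have h1 : p ^+ 2 <= p by rewrite expr2 ler_piMr// ltW.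
    have h2 : C * p ^+ 2 <= C * (2 * q) by rewrite ler_wpM2l//; lra.
    have h3 : 4 * C * q <= K * q by rewrite ler_pM2r.
    lra.
  lra.
have {}dg := dg x0.
(* [y - c * y ^+ 2] increases up to [1 / (2 * c)]. If [K * p] lies before this peak, it may replace
   [x]; otherwise [c * K * q > 1 / 4] and the a priori bound [1 / (8 * c)] suffices. *)
have [Kp|Kp] := leP (2 * (c * K * p)) 1.
  have h1 : 0 <= (K * p - x) * (1 - c * (K * p + x)).
    rewrite mulr_ge0 ?subr_ge0//.
    have : c * x <= c * (K * p) by rewrite ler_pM2l.
    by rewrite mulrDr; lra.
  have h2 : (K + 2 * C) * p ^+ 2 <= c * K * K * p ^+ 2.
    rewrite ler_wpM2r ?sqr_ge0//.
    have : 2 * K <= c * K * K by rewrite ler_pM2r.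
    lra.
  have h3 : K * (p - q) <= K * p ^+ 2 by rewrite ler_pM2l.
  have h4 : (K * p - x) * (1 - c * (K * p + x)) =
    K * p - x + c * x ^+ 2 - c * K * K * p ^+ 2 by ring.
  rewrite h4 in h1; lra.
have h5 : c * K * p <= c * K * (2 * q) by rewrite ler_wpM2l//; lra.
rewrite -(ler_pM2l c0); lra.
Qed.

(** * The inexact augmented Lagrangian method in an abstract setting *)

Section AugmentedLagrangian.
Context (R : realFieldType) (X : Type) (ok : X -> Prop) (m : nat).
Context (f : X -> R) (v : X -> 'I_m -> R) (beta : R).
Implicit Types (x y z : X) (lam : 'I_m -> R).

Definition slack x lam i := Num.min (v x i) (lam i / beta).

Definition aug x lam :=
  f x + \sum_i (lam i * slack x lam i - beta / 2 * slack x lam i ^+ 2).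

Hypothesis beta_gt0 : 0 < beta.
(** Stands in for convexity: the values are averaged, while [z] itself need not be a mean of [x] and
    [y], as policy values are not linear in the policy. *)
Hypothesis midpoint : forall x y, ok x -> ok y -> exists z,
  [/\ ok z, f z = (f x + f y) / 2 & forall i, v z i = (v x i + v y i) / 2].

Lemma aug_ge x lam (w : 'I_m -> R) : (forall i, w i <= v x i) ->
  f x + \sum_i (lam i * w i - beta / 2 * w i ^+ 2) <= aug x lam.
Proof.
by move=> wv; rewrite lerD2l; apply: ler_sum => i _; exact: min_slack_maximizes.
Qed.

Lemma aug_feasible x lam : (forall i, 0 <= v x i) -> f x <= aug x lam.
Proof.
move=> vx; apply: le_trans (@aug_ge x lam (fun=> 0) vx).
by rewrite big1 ?addr0// => i _; rewrite mulr0 expr0n mulr0 subr0.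
Qed.

Lemma slack_le x lam i : slack x lam i <= v x i.
Proof. by rewrite /slack ge_min lexx. Qed.

(* [aug] is strongly concave in the slack variable, so a near-maximizer at [lam]
   has almost the slack of the maximizer; this makes the dual function smooth. *)
Lemma aug_descent x y lam lam' eps : ok x -> ok y ->
  (forall z, ok z -> aug z lam <= aug x lam + eps) ->
  (forall i, lam' i = lam i - beta / 2 * slack x lam i) ->
  aug y lam' <= aug x lam + 2 * eps - beta / 4 * \sum_i slack x lam i ^+ 2.
Proof.
move=> okx oky xopt lamE; have [z [okz fz vz]] := midpoint okx oky.
set w := slack x lam in lamE *; set w' := slack y lam'.
have := xopt z okz.
have := @aug_ge z lam (fun i => (w i + w' i) / 2).
have wz i : (w i + w' i) / 2 <= v z i.
  by rewrite vz; have := slack_le x lam i; have := slack_le y lam' i; rewrite /w /w'; lra.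
move=> /(_ wz); rewrite fz.
(* Strong concavity: the midpoint gains [beta / 8 * (w i - w' i) ^+ 2] over the average. *)
have E : \sum_i (lam i * ((w i + w' i) / 2) - beta / 2 * ((w i + w' i) / 2) ^+ 2) =
   (\sum_i (lam i * w i - beta / 2 * w i ^+ 2)) / 2 +
   (\sum_i (lam i * w' i - beta / 2 * w' i ^+ 2 + beta / 4 * (w i - w' i) ^+ 2)) / 2.
  rewrite !mulr_suml -big_split /=; apply: eq_bigr => i _; by field.
rewrite E => h1 h2.
(* The cross term of the square is exactly the change from [lam] to [lam']; this is where the step
   length [beta / 2] fits. *)
have h3 : \sum_i (lam' i * w' i - beta / 2 * w' i ^+ 2) + beta / 4 * (\sum_i w i ^+ 2)
   <= \sum_i (lam i * w' i - beta / 2 * w' i ^+ 2 + beta / 4 * (w i - w' i) ^+ 2).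
  rewrite mulr_sumr -big_split /=; apply: ler_sum => i _.
  rewrite lamE -subr_ge0 (_ : _ - _ = beta / 4 * w' i ^+ 2); last by field.
  by rewrite mulr_ge0 ?sqr_ge0// divr_ge0// ltW.
move: h1 h2; rewrite /aug -/w -/w'; lra.
Qed.

Section Multiplier.
Context (mu : 'I_m -> R) (fs : R).
Hypothesis mu_ge0 : forall i, 0 <= mu i.
Hypothesis mu_dual : forall x, ok x -> f x + \sum_i mu i * v x i <= fs.
(** Says that [fs] is at most the supremum of [f] over feasible points, phrased by upper bounds
    because [R] is only a real field here. *)
Hypothesis fs_least : forall u,
  (forall y, ok y -> (forall i, 0 <= v y i) -> f y <= u) -> fs <= u.

(** Weak duality: since [mu] is nonnegative and [slack] lies below [v], [mu_dual] survives replacing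
    [v] by [slack]. *)
Lemma aug_upper x lam : ok x -> aug x lam - fs <=
  \sum_i (lam i - mu i) * slack x lam i - beta / 2 * \sum_i slack x lam i ^+ 2.
Proof.
move=> okx; have := mu_dual okx.
have : \sum_i mu i * slack x lam i <= \sum_i mu i * v x i.
  by apply: ler_sum => i _; rewrite ler_wpM2l ?slack_le.
rewrite /aug !mulr_sumr -sumrB.
set s := \sum_i mu i * slack x lam i => h1 h2.
rewrite [X in _ <= X](_ : _ = \sum_i (lam i * slack x lam i - beta / 2 * slack x lam i ^+ 2) - s).
  lra.
by rewrite /s -sumrB; apply: eq_bigr => i _; ring.
Qed.

Lemma fs_le_aug x lam eps : ok x ->
  (forall z, ok z -> aug z lam <= aug x lam + eps) -> fs <= aug x lam + eps.
Proof.
move=> okx xopt; apply: fs_least => y oky vy.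
by apply: le_trans (xopt _ oky); exact: aug_feasible.
Qed.

(** With [W] the sum of squared slacks, [aug_upper] and [fs_le_aug] bound the cross term of the
    expanded square by [beta * eps - beta ^+ 2 / 2 * W], which absorbs the quadratic term
    [beta ^+ 2 / 4 * W]. *)
Lemma dual_distance_step x lam lam' eps : ok x ->
  (forall z, ok z -> aug z lam <= aug x lam + eps) ->
  (forall i, lam' i = lam i - beta / 2 * slack x lam i) ->
  \sum_i (lam' i - mu i) ^+ 2 <= \sum_i (lam i - mu i) ^+ 2 + beta * eps.
Proof.
move=> okx xopt lamE.
have h1 := fs_le_aug okx xopt; have h2 := aug_upper lam okx.
have S0 : 0 <= \sum_i slack x lam i ^+ 2.
  by apply: sumr_ge0 => i _; exact: sqr_ge0.
have -> : \sum_i (lam' i - mu i) ^+ 2 = \sum_i (lam i - mu i) ^+ 2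
   - beta * \sum_i (lam i - mu i) * slack x lam i
   + beta ^+ 2 / 4 * \sum_i slack x lam i ^+ 2.
  rewrite !mulr_sumr -sumrB -big_split /=; apply: eq_bigr => i _.
  by rewrite lamE; field.
have : beta * (fs - aug x lam) <= beta * eps by rewrite ler_pM2l//; lra.
have : beta * (aug x lam - fs) <= beta * (\sum_i (lam i - mu i) * slack x lam i
   - beta / 2 * \sum_i slack x lam i ^+ 2) by rewrite ler_pM2l.
have : 0 <= beta ^+ 2 / 4 * \sum_i slack x lam i ^+ 2.
  by rewrite mulr_ge0// divr_ge0// sqr_ge0.
lra.
Qed.

Lemma iter_complexity (C : R) : 0 <= C -> exists CT, 0 < CT /\
  forall (eps : R) (T : nat), 0 < eps < 1 -> CT / eps ^+ 2 <= T%:R ->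
  forall (pi : nat -> X) (lam : nat -> 'I_m -> R),
    (forall i, lam 1%N i = 0) ->
    (forall t, (1 <= t <= T)%N ->
       [/\ ok (pi t.+1),
           forall z, ok z -> aug z (lam t) <= aug (pi t.+1) (lam t) + C / t%:R ^+ 2 &
           forall i, lam t.+1 i = lam t i - beta / 2 * slack (pi t.+1) (lam t) i]) ->
    fs - eps <= f (pi T.+1) /\ (forall i, - eps <= v (pi T.+1) i).
Proof.
move=> C0.
(* [N] is the initial squared distance to [mu], as [lam 1] is 0; [4 * (beta * C)] covers the
   accumulated oracle errors and [1] keeps [R2] positive. [M / T] will bound the squared slacks at
   the last step, and [L2] the squared norm of [lam T]. *)
pose N := \sum_i mu i ^+ 2; pose R2 := N + 4 * (beta * C) + 1.
pose c := beta / (4 * R2); pose K := 2 / c + 4 * C.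
pose M := 4 / beta * (K + 2 * C); pose L2 := 2 * (R2 + N).
have N0 : 0 <= N by apply: sumr_ge0 => i _; exact: sqr_ge0.
have bC0 : 0 <= beta * C by rewrite mulr_ge0// ltW.
have R20 : 0 < R2 by rewrite /R2; lra.
have c0 : 0 < c by rewrite divr_gt0// mulr_gt0.
have K0 : 0 < K by apply: ltr_wpDr; [exact: mulr_ge0|exact: divr_gt0].
have M0 : 0 < M by rewrite mulr_gt0 ?divr_gt0//; apply: ltr_wpDr => //; exact: mulr_ge0.
have L20 : 0 < L2 by rewrite mulr_gt0//; exact: ltr_wpDr.
have LM0 : 0 < L2 * M by rewrite mulr_gt0.
(* [M] serves the violation, [2 * C] the last oracle error, and [4 * (L2 * M)] keeps the sum of
   [lam T i * w T i] below [eps / 2]. *)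
exists (M + 2 * C + 4 * (L2 * M)); split; first lra.
move=> eps T /andP[e0 e1] hT pi lam lam1 step.
have e20 : 0 < eps ^+ 2 by rewrite exprn_gt0.
rewrite ler_pdivrMr// in hT.
have T0 : (0 < T)%N.
  rewrite lt0n; apply/eqP => T0; move: hT; rewrite T0 mul0r; lra.
pose w t := slack (pi t.+1) (lam t); pose W t := \sum_i w t i ^+ 2.
pose d t := aug (pi t.+1) (lam t) - fs.
have W0 t : 0 <= W t by apply: sumr_ge0 => i _; exact: sqr_ge0.
have dist t : (1 <= t <= T)%N -> \sum_i (lam t i - mu i) ^+ 2 <= R2.
  (* The term [- 2 / t] strengthens the induction: each [1 / t ^ 2] is at most
     [2 / t - 2 / (t + 1)]. *)
  suff h : (1 <= t <= T)%N -> \sum_i (lam t i - mu i) ^+ 2 <=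
      N + beta * C * (4 - 2 / t%:R).
    move=> tT; apply: le_trans (h tT) _; rewrite /R2.
    have : 0 <= beta * C * (2 / t%:R) by rewrite mulr_ge0// divr_ge0.
    lra.
  elim: t => // -[_ _|t IH tT].
    rewrite divr1 (_ : \sum_i _ = N); last first.
      by apply: eq_bigr => i _; rewrite lam1 sub0r sqrrN.
    lra.
  have tT' : (1 <= t.+1 <= T)%N by case/andP: tT => _ /ltnW ->.
  have [okx xopt lamE] := step _ tT'.
  apply: le_trans (dual_distance_step okx xopt lamE) _.
  have := IH tT'.
  have [//|q0 p1 _ pq' _] := @inv_succ_bounds R t.+1.
  rewrite -exprVn; move: pq'; set p := (t.+1%:R)^-1; set q := (t.+2%:R)^-1.
  move=> /(ler_wpM2l bC0); lra.
have dupper t : (1 <= t <= T)%N ->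
    d t <= \sum_i (lam t i - mu i) * w t i - beta / 2 * W t.
  by move=> tT; have [okx _ _] := step _ tT; exact: aug_upper.
have CS t : (1 <= t <= T)%N -> (\sum_i (lam t i - mu i) * w t i) ^+ 2 <= R2 * W t.
  move=> tT; apply: le_trans (cauchy_schwarz_sum _ _) _.
  by apply: ler_wpM2r; [exact: W0 | exact: dist].
have rate : forall t, (1 <= t <= T)%N -> d t <= K / t%:R.
  apply: (@quadratic_decay_rate R c C K d (fun t => beta / 4 * W t) T c0 C0) => //.
  - move=> t tT; apply: le_trans (dupper t tT) _.
    have -> : (8 * c)^-1 = R2 / (2 * beta).
      by rewrite /c; field; rewrite !gt_eqF.
    rewrite ler_pdivlMr ?mulr_gt0//.
    (* Completing the square maximizes the bound [dupper] over all slacks. *)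
    have : 0 <= \sum_i (lam t i - mu i - beta * w t i) ^+ 2.
      by apply: sumr_ge0 => i _; exact: sqr_ge0.
    have -> : \sum_i (lam t i - mu i - beta * w t i) ^+ 2 =
      \sum_i (lam t i - mu i) ^+ 2 - 2 * beta * (\sum_i (lam t i - mu i) * w t i)
       + beta ^+ 2 * W t.
      rewrite /W !mulr_sumr -sumrB -big_split /=; apply: eq_bigr => i _; ring.
    have := dist t tT; lra.
  - by move=> t _; rewrite mulr_ge0// divr_ge0// ltW.
  - move=> t tT dt0.
    have h : d t <= \sum_i (lam t i - mu i) * w t i.
      apply: le_trans (dupper t tT) _.
      by rewrite gerBl mulr_ge0// divr_ge0// ltW.
    have : d t ^+ 2 <= R2 * W t.
      by apply: le_trans (CS t tT); rewrite ler_pXn2r// ?nnegrE// (le_trans dt0).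
    move=> h2; rewrite (_ : beta / 4 * W t = c * (R2 * W t)) ?ler_pM2l//.
    by rewrite /c; field; rewrite gt_eqF.
  - move=> t /andP[t1 tT].
    have [okx xopt lamE] := step t (introT andP (conj t1 (ltnW tT))).
    have [oky _ _] := step t.+1 tT.
    have := aug_descent okx oky xopt lamE; rewrite /d -/(W t); lra.
have TT : (1 <= T <= T)%N by rewrite T0 leqnn.
have [okx xopt lamE] := step T TT.
set x := pi T.+1 in okx xopt lamE *.
have {}rate : aug x (lam T) - fs <= K / T%:R by exact: rate.
have T1 : 1 <= T%:R :> R by rewrite (ler_nat R 1 T).
have Tp : 0 < T%:R :> R by lra.
rewrite -exprVn in xopt; set p := (T%:R : R)^-1 in rate xopt.
have p0 : 0 < p by rewrite invr_gt0.
have p1 : p <= 1 by rewrite invf_le1.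
have p2p : p ^+ 2 <= p by rewrite expr2 ler_piMr// ltW.
have Cp : C * p ^+ 2 <= C * p by rewrite ler_wpM2l.
have pT : (M + 2 * C + 4 * (L2 * M)) * p <= eps ^+ 2.
  by rewrite /p ler_pdivrMr// [leRHS]mulrC.
have W_T : W T <= M * p.
  (* Descent compares the last iterate with an arbitrary feasible [y] at [lam T.+1], so no further
     oracle call enters. *)
  have : fs <= aug x (lam T) + 2 * (C * p ^+ 2) - beta / 4 * W T.
    apply: fs_least => y oky vy.
    apply: le_trans (aug_feasible (lam T.+1) vy) _.
    exact: aug_descent okx oky xopt lamE.
  move=> h; rewrite /M -mulrA -ler_pdivrMl ?divr_gt0//.
  rewrite (_ : (4 / beta)^-1 = beta / 4); last by rewrite invf_div.
  lra.
have LMp0 : 0 <= L2 * M * p by rewrite mulr_ge0// ltW.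
have Cp0 : 0 <= C * p by rewrite mulr_ge0// ltW.
have Mp0 : 0 <= M * p by rewrite mulr_ge0// ltW.
have e2e : eps ^+ 2 <= eps by rewrite expr2 ler_piMr// ltW.
split.
  have L : \sum_i lam T i ^+ 2 <= L2.
    rewrite /L2 mulrDr.
    apply: (@le_trans _ _ (2 * (\sum_i (lam T i - mu i) ^+ 2) + 2 * N)); last first.
      by rewrite lerD2r ler_pM2l// dist.
    rewrite !mulr_sumr -big_split /=; apply: ler_sum => i _.
    rewrite -subr_ge0 (_ : _ - _ = (lam T i - 2 * mu i) ^+ 2) ?sqr_ge0//; ring.
  have CSl : \sum_i lam T i * w T i <= eps / 2.
    have [?|h0] := leP (\sum_i lam T i * w T i) 0; first lra.
    rewrite -(@ler_pXn2r _ 2)// ?nnegrE; [|lra|lra].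
    apply: le_trans (cauchy_schwarz_sum _ _) _; rewrite -/(W T).
    apply: (@le_trans _ _ (L2 * (M * p))).
      by apply: ler_pM => //; apply: sumr_ge0 => i _; exact: sqr_ge0.
    rewrite expr_div_n; lra.
  have Ce : C * p ^+ 2 <= eps / 2 by lra.
  have := fs_le_aug okx xopt.
  rewrite {1}/aug sumrB -mulr_sumr -/(W T) -/(w T).
  have : 0 <= beta / 2 * W T by rewrite mulr_ge0// divr_ge0// ltW.
  lra.
move=> i; apply: le_trans (slack_le _ (lam T) _).
have : w T i ^+ 2 <= eps ^+ 2.
  apply: (@le_trans _ _ (W T)); last lra.
  by rewrite /W (bigD1 i)//= lerDl; apply: sumr_ge0 => j _; exact: sqr_ge0.
move=> h; rewrite -/(w T i) lerNl.
have [?|h0] := leP 0 (w T i); first lra.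
rewrite -(@ler_pXn2r _ 2)// ?nnegrE; [by rewrite sqrrN|lra|lra].
Qed.

End Multiplier.
End AugmentedLagrangian.

(** * Occupancy measures of stationary policies *)

Lemma sum_cvg (R : realType) (I : finType) (F : I -> nat -> R) (l : I -> R) :
  (forall i, F i n @[n --> \oo] --> l i)%classic ->
  (\sum_i F i n @[n --> \oo] --> \sum_i l i)%classic.
Proof. by move=> Fl; apply: cvg_big => //; exact: add_continuous. Qed.

Lemma big_pair (R : realType) (I J : finType) (F : I * J -> R) :
  \sum_t F t = \sum_i \sum_j F (i, j).
Proof. by rewrite pair_bigA; apply: eq_bigr => -[]. Qed.

Section Occupancy.
Local Open Scope classical_set_scope.
Context (R : realType) (S A : finType) (P : S -> A -> S -> R) (gamma : R).
Hypothesis P_kernel : is_kernel P.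
Hypothesis gamma_bounds : 0 <= gamma < 1.

Lemma occ_ge0 pi s a n s' a' : is_policy pi -> 0 <= occ P pi s a n s' a'.
Proof.
move=> [pi0 _]; case: P_kernel => P0 _.
elim: n s' a' => [|n IH] s' a' /=; first by case: ifP.
by apply: sumr_ge0 => s1 _; apply: sumr_ge0 => a1 _; rewrite !mulr_ge0.
Qed.

Lemma occ_sum pi s a n : is_policy pi ->
  \sum_(t : S * A) occ P pi s a n t.1 t.2 = 1.
Proof.
move=> [_ pi1]; case: P_kernel => _ P1.
elim: n => [|n IH] /=.
  rewrite (bigD1 (s, a))//= !eqxx/= big1 ?addr0// => -[s1 a1].
  by rewrite xpair_eqE => /negbTE /= ->.
rewrite -(pair_bigA _ (fun s' a' => \sum_s1 \sum_a1
  occ P pi s a n s1 a1 * P s1 a1 s' * pi s' a'))/=.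
rewrite -[RHS]IH.
under eq_bigr do under eq_bigr do
  rewrite (pair_bigA _ (fun s1 a1 => occ P pi s a n s1 a1 * P s1 a1 _ * pi _ _)).
under eq_bigr do rewrite exchange_big /=.
rewrite exchange_big /=; apply: eq_bigr => t _.
under eq_bigr do rewrite -mulr_sumr pi1 mulr1.
by rewrite -mulr_sumr P1 mulr1.
Qed.

Definition docc_part pi s a n (t : S * A) :=
  \sum_(0 <= k < n) gamma ^+ k * occ P pi s a k t.1 t.2.

(** The discounted occupancy measure of a start at [(s, a)], left unnormalized: for a policy its
    mass is [1 / (1 - gamma)]. *)
Definition docc pi s a (t : S * A) := limn (fun n => docc_part pi s a n t).

Lemma docc_cvg pi s a t : is_policy pi ->
  docc_part pi s a n t @[n --> \oo] --> docc pi s a t.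
Proof.
move=> pol; have /andP[g0 g1] := gamma_bounds.
have : cvgn (series (geometric 1 gamma)).
  by apply: is_cvg_geometric_series; rewrite ger0_norm.
apply: series_le_cvg => n /=.
- by rewrite mulr_ge0 ?exprn_ge0 ?occ_ge0.
- by rewrite mul1r exprn_ge0.
- rewrite mul1r ler_piMr ?exprn_ge0//.
  rewrite -(occ_sum s a n pol) (bigD1 t)//= lerDl.
  by apply: sumr_ge0 => u _; rewrite occ_ge0.
Qed.

Lemma docc_ge0 pi s a t : is_policy pi -> 0 <= docc pi s a t.
Proof.
move=> pol; apply: limr_ge; first exact: cvgP (docc_cvg pol).
apply: nearW => n; apply: sumr_ge0 => k _; rewrite mulr_ge0 ?occ_ge0//.
by rewrite exprn_ge0//; case/andP: gamma_bounds.
Qed.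

Lemma Qfun_docc pi u s a : is_policy pi ->
  Qfun P gamma pi u s a = \sum_t docc pi s a t * u t.1 t.2.
Proof.
move=> pol; apply/cvg_lim => //.
rewrite (_ : (fun n => _) = fun n => \sum_t docc_part pi s a n t * u t.1 t.2).
  by apply: sum_cvg => t; apply: cvgMr_tmp; exact: docc_cvg.
apply/funext => n; rewrite /docc_part.
under [RHS]eq_bigr do rewrite mulr_suml.
rewrite exchange_big /=; apply: eq_bigr => k _.
rewrite pair_bigA /= mulr_sumr; apply: eq_bigr => t _; by rewrite mulrA.
Qed.

(** Time 0 gives the point mass; the later times are one transition applied to the whole measure, as
    shifting the partial sums shows. *)
Lemma docc_fixpoint pi s a s' a' : is_policy pi ->
  docc pi s a (s', a') = ((s', a') == (s, a))%:R
     + gamma * (\sum_t docc pi s a t * P t.1 t.2 s') * pi s' a'.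
Proof.
move=> pol; have h := docc_cvg (s := s) (a := a) (t := (s', a')) pol.
rewrite -cvg_shiftS in h; apply: (cvg_unique _ h) => //.
have -> : (fun n => docc_part pi s a n.+1 (s', a')) = fun n =>
   ((s', a') == (s, a))%:R + gamma * (\sum_t docc_part pi s a n t * P t.1 t.2 s') * pi s' a'.
  apply/funext => n; rewrite /docc_part big_nat_recl//= expr0 mul1r; congr (_ + _).
    by rewrite xpair_eqE; case: ifP.
  under [X in gamma * X]eq_bigr do rewrite mulr_suml.
  rewrite exchange_big /= mulr_sumr mulr_suml; apply: eq_bigr => k _.
  rewrite (pair_bigA _ (fun s1 a1 => occ P pi s a k s1 a1 * P s1 a1 s' * pi s' a')) /=.
  rewrite !mulr_sumr mulr_suml; apply: eq_bigr => t _; rewrite exprS; ring.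
apply: cvgD; first exact: cvg_cst.
apply: cvgMr_tmp; apply: cvgMl_tmp; apply: sum_cvg => t.
by apply: cvgMr_tmp; exact: docc_cvg.
Qed.

Section InitialDistribution.
Context (rho : S -> R).
Hypothesis rho_dist : is_dist rho.

(** The Bellman flow equations; with nonnegativity they cut out the polytope of occupancy
    measures. *)
Definition flow (x : S * A -> R) := forall s',
  \sum_a x (s', a) = rho s' + gamma * \sum_t x t * P t.1 t.2 s'.

Definition occupancy pi (t : S * A) := \sum_s rho s * \sum_a pi s a * docc pi s a t.

Lemma occupancy_ge0 pi t : is_policy pi -> 0 <= occupancy pi t.
Proof.
move=> pol; case: rho_dist => rho0 _; case: (pol) => pi0 _.
apply: sumr_ge0 => s _; rewrite mulr_ge0//.
by apply: sumr_ge0 => a _; rewrite mulr_ge0 ?docc_ge0.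
Qed.

Lemma occupancy_sumE pi (u : S * A -> R) :
  \sum_t occupancy pi t * u t
  = \sum_s rho s * \sum_a pi s a * \sum_t docc pi s a t * u t.
Proof.
under eq_bigr do rewrite mulr_suml.
rewrite exchange_big /=; apply: eq_bigr => s _.
under eq_bigr do rewrite -mulrA mulr_suml.
rewrite -mulr_sumr exchange_big /=; congr (_ * _); apply: eq_bigr => a _.
by rewrite mulr_sumr; apply: eq_bigr => t _; rewrite mulrA.
Qed.

Lemma Vrho_occupancy pi u : is_policy pi ->
  Vrho P rho gamma pi u = \sum_t occupancy pi t * u t.1 t.2.
Proof.
move=> pol; rewrite occupancy_sumE; apply: eq_bigr => s _; congr (_ * _).
by apply: eq_bigr => a _; rewrite Qfun_docc.
Qed.

Lemma occupancy_fixpoint pi s' a' : is_policy pi ->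
  occupancy pi (s', a') =
  (rho s' + gamma * \sum_t occupancy pi t * P t.1 t.2 s') * pi s' a'.
Proof.
move=> pol; rewrite occupancy_sumE /occupancy.
under eq_bigr => s _ do under eq_bigr => a _ do rewrite docc_fixpoint// mulrDr.
under eq_bigr => s _ do rewrite big_split mulrDr /=.
rewrite big_split mulrDl /=; congr (_ + _).
  rewrite (bigD1 s')//= (bigD1 a')//= eqxx mulr1 !big1 ?addr0//.
    move=> s ss'; rewrite big1 ?mulr0// => a _.
    by rewrite xpair_eqE eq_sym (negbTE ss') mulr0.
  by move=> a aa'; rewrite xpair_eqE eqxx/= eq_sym (negbTE aa') mulr0.
rewrite mulr_sumr mulr_suml; apply: eq_bigr => s _.
rewrite mulrCA -mulrA; congr (_ * _).
rewrite mulr_sumr mulr_suml; apply: eq_bigr => a _; ring.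
Qed.

Lemma occupancy_flow pi : is_policy pi -> flow (occupancy pi).
Proof.
move=> pol s'; under eq_bigr do rewrite occupancy_fixpoint//.
by rewrite -mulr_sumr; case: pol => _ ->; rewrite mulr1.
Qed.

(* Given the policy, the state-action flow equation is a contraction for the
   l1-norm, with ratio gamma, so its solution is unique. *)
Lemma occupancy_unique pi x : is_policy pi -> flow x ->
  (forall s a, x (s, a) = (\sum_b x (s, b)) * pi s a) -> x =1 occupancy pi.
Proof.
move=> pol fx xpi; have /andP[g0 g1] := gamma_bounds.
case: P_kernel => P0 P1; case: (pol) => pi0 pi1.
pose e t := x t - occupancy pi t.
have eE s a : e (s, a) = gamma * (\sum_t e t * P t.1 t.2 s) * pi s a.
  rewrite /e xpi fx occupancy_fixpoint// -mulrBl; congr (_ * _).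
  under [in RHS]eq_bigr do rewrite mulrBl.
  by rewrite sumrB; ring.
have le_e : \sum_t `|e t| <= gamma * \sum_t `|e t|.
  have -> : gamma * \sum_t `|e t|
      = \sum_s \sum_a gamma * (\sum_t `|e t| * P t.1 t.2 s) * pi s a.
    under [RHS]eq_bigr do rewrite -mulr_sumr pi1 mulr1.
    rewrite -mulr_sumr exchange_big /=; congr (_ * _); apply: eq_bigr => t _.
    by rewrite -mulr_sumr P1 mulr1.
  rewrite pair_bigA /=; apply: ler_sum => -[s a] _ /=.
  rewrite eE !normrM (ger0_norm g0) (ger0_norm (pi0 s a)) ler_wpM2r// ler_wpM2l//.
  apply: le_trans (ler_norm_sum _ _ _) _; apply: ler_sum => t _.
  by rewrite normrM (ger0_norm (P0 _ _ _)).
have E0 : 0 <= \sum_t `|e t| by apply: sumr_ge0.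
have : \sum_t `|e t| = 0.
  apply/eqP; rewrite eq_le E0 andbT -(pmulr_rle0 _ (_ : 0 < 1 - gamma)) ?subr_gt0//.
  by rewrite mulrBl mul1r subr_le0.
move=> /eqP; rewrite psumr_eq0// => /allP h t.
by have := h t (mem_index_enum _); rewrite normr_eq0 subr_eq0 => /eqP.
Qed.

(** Converse of [occupancy_flow]: conditioning [x] on the state gives a policy, whose occupancy
    measure is [x] by [occupancy_unique]. *)
Lemma flow_policy x : (exists pi, @is_policy R S A pi) ->
  (forall t, 0 <= x t) -> flow x ->
  exists pi, is_policy pi /\
    forall u, Vrho P rho gamma pi u = \sum_t x t * u t.1 t.2.
Proof.
move=> [pid [pid0 pid1]] x0 fx; pose y s := \sum_b x (s, b).
have y0 s : 0 <= y s by apply: sumr_ge0.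
(* At a state of mass 0 the quotients form no distribution, so [pid] supplies one; [x] vanishes
   there whatever the choice. *)
pose pi s a := if y s == 0 then pid s a else x (s, a) / y s.
have pol : is_policy pi.
  split=> s; rewrite /pi; first by move=> a; case: ifP => // _; rewrite divr_ge0.
  by case: eqP => [_|/eqP ys]; [exact: pid1|rewrite -mulr_suml divff].
exists pi; split => // u; rewrite Vrho_occupancy//; apply: eq_bigr => t _; congr (_ * _).
symmetry; apply: occupancy_unique => // s a; rewrite -/(y s) /pi.
case: eqP => [ys|/eqP ys]; last by rewrite mulrC divfK.
rewrite ys mul0r; move/eqP: ys; rewrite psumr_eq0// => /allP /(_ a (mem_index_enum _)).
by move=> /eqP.
Qed.

Lemma flow_mass x : flow x -> (1 - gamma) * \sum_t x t = 1.
Proof.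
move=> fx; case: P_kernel => _ P1; case: rho_dist => _ rho1.
have : \sum_t x t = 1 + gamma * \sum_t x t.
  rewrite {1}big_pair (eq_bigr _ (fun s _ => fx s)) big_split /= rho1 -mulr_sumr exchange_big /=.
  by congr (1 + gamma * _); apply: eq_bigr => t _; rewrite -mulr_sumr P1 mulr1.
lra.
Qed.

Lemma Vrho_le pi u : is_policy pi -> (forall s a, u s a <= 1) ->
  Vrho P rho gamma pi u <= (1 - gamma)^-1.
Proof.
move=> pol u1; have /andP[_ g1] := gamma_bounds; rewrite Vrho_occupancy//.
have m := flow_mass (occupancy_flow pol).
have -> : (1 - gamma)^-1 = \sum_t occupancy pi t.
  by apply: (mulfI (_ : 1 - gamma != 0)); rewrite ?m ?divff// subr_eq0 gt_eqF.
by apply: ler_sum => t _; rewrite ler_piMr// occupancy_ge0.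
Qed.

(** Occupancy measures are averaged, since their flow equations are affine; [flow_policy] leads back
    to a policy. *)
Lemma Vrho_midpoint pi1 pi2 : is_policy pi1 -> is_policy pi2 ->
  exists pi, is_policy pi /\ forall u,
    Vrho P rho gamma pi u = (Vrho P rho gamma pi1 u + Vrho P rho gamma pi2 u) / 2.
Proof.
move=> pol1 pol2.
pose x t := (occupancy pi1 t + occupancy pi2 t) / 2.
have [|||pi [pol V]] := @flow_policy x.
- by exists pi1.
- by move=> t; rewrite divr_ge0// addr_ge0// occupancy_ge0.
- move=> s; rewrite /x -mulr_suml big_split /= !occupancy_flow//.
  under [in RHS]eq_bigr do rewrite mulrAC mulrDl.
  rewrite -mulr_suml big_split /=; by field.
exists pi; split => // u; rewrite V !Vrho_occupancy// -big_split mulr_suml /=.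
by apply: eq_bigr => t _; rewrite /x; ring.
Qed.

(** * Lagrange multipliers from linear programming duality *)

Section Multipliers.
Context (r : S -> A -> R) (m : nat) (c : 'I_m -> S -> A -> R) (b : 'I_m -> R).
Hypothesis r_le1 : forall s a, r s a <= 1.
Hypothesis feasible_ex : exists pi, is_policy pi /\ feasible P rho gamma c b pi.

Lemma feasible_le_Vstar pi : is_policy pi -> feasible P rho gamma c b pi ->
  Vrho P rho gamma pi r <= Vstar P rho gamma r c b.
Proof.
move=> pol fpi; apply: ub_le_sup; last by exists pi.
by exists (1 - gamma)^-1 => _ [q [polq [_ ->]]]; exact: Vrho_le.
Qed.

(** Feasibility enters because [sup] of the empty set is the default value 0. *)
Lemma Vstar_le u : (forall pi, is_policy pi -> feasible P rho gamma c b pi ->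
  Vrho P rho gamma pi r <= u) -> Vstar P rho gamma r c b <= u.
Proof.
move=> H; apply: ge_sup.
  by have [pi [pol fpi]] := feasible_ex; exists (Vrho P rho gamma pi r), pi.
by move=> _ [q [polq [fq ->]]]; exact: H.
Qed.

(* The CMDP is a linear program in the occupancy measure, so multipliers exist
   without any Slater condition. The program is homogenized by substituting
   [(1 - gamma) * \sum_t x t], which is 1 on occupancy measures, for each constant. *)
Lemma lagrange_multipliers : exists mu : 'I_m -> R, (forall i, 0 <= mu i) /\
  forall pi, is_policy pi -> Vrho P rho gamma pi r +
    \sum_i mu i * (Vrho P rho gamma pi (c i) - b i) <= Vstar P rho gamma r c b.
Proof.
have /andP[g0 g1] := gamma_bounds.
set fs := Vstar _ _ _ _ _ _.
pose E s (t : S * A) := (t.1 == s)%:R - gamma * P t.1 t.2 s - (1 - gamma) * rho s.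
have EE s x : \sum_t E s t * x t = \sum_a x (s, a) - gamma * (\sum_t x t * P t.1 t.2 s)
    - (1 - gamma) * rho s * \sum_t x t.
  rewrite (eq_bigr (fun t => (t.1 == s)%:R * x t - gamma * (x t * P t.1 t.2 s)
      - (1 - gamma) * rho s * x t)); last by move=> t _; rewrite /E; ring.
  rewrite !sumrB -!mulr_sumr; congr (_ - _ - _).
  rewrite big_pair (bigD1 s)//= [X in _ + X]big1 ?addr0.
    by apply: eq_bigr => a _; rewrite eqxx mul1r.
  by move=> s1 /negbTE ss1; apply: big1 => a _; rewrite ss1 mul0r.
(* Rows for nonnegativity, for the flow equations as pairs of opposite inequalities, and for the
   constraints. *)
pose J : finType := ((S * A) + (S + S) + 'I_m)%type.
pose a (j : J) (t : S * A) : R := match j with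
  | inl (inl t0) => - (t == t0)%:R
  | inl (inr (inl s)) => E s t
  | inl (inr (inr s)) => - E s t
  | inr i => (1 - gamma) * b i - c i t.1 t.2
  end.
pose g (t : S * A) := r t.1 t.2 - (1 - gamma) * fs.
have gE (k : R) u (x : S * A -> R) : \sum_t (u t - (1 - gamma) * k) * x t =
    \sum_t x t * u t - k * ((1 - gamma) * \sum_t x t).
  rewrite !mulr_sumr -sumrB; apply: eq_bigr => t _; ring.
have [|mu [mu0 gmu]] := @farkas R (S * A)%type J a g.
  move=> x ax.
  have x0 t : 0 <= x t.
    have := ax (inl (inl t)); rewrite (bigD1 t)//= eqxx big1 ?addr0.
      by rewrite mulN1r oppr_le0.
    by move=> u /negbTE; rewrite /a => ->; rewrite oppr0 mul0r.
  have flx s : \sum_t E s t * x t = 0.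
    apply/eqP; rewrite eq_le; have := ax (inl (inr (inl s))) => /= ->/=.
    have := ax (inl (inr (inr s))) => /=.
    by under eq_bigr do rewrite mulNr; rewrite sumrN oppr_le0.
  have cx i : b i * ((1 - gamma) * \sum_t x t) <= \sum_t x t * c i t.1 t.2.
    have := ax (inr i) => /=.
    under eq_bigr do rewrite -opprB mulNr.
    by rewrite sumrN oppr_le0 gE subr_ge0.
  rewrite /g gE; set X := \sum_t x t in flx cx *.
  have X0 : 0 <= X by apply: sumr_ge0.
  (* Mass 0 forces [x = 0]. Otherwise division by [z] gives mass [1 / (1 - gamma)], hence a solution
     of [flow]. *)
  have [X1|X1] := eqVneq X 0.
    rewrite X1 !mulr0 subr0 big1// => t _.
    move/eqP: X1; rewrite psumr_eq0// => /allP /(_ t (mem_index_enum _)) /eqP ->.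
    by rewrite mul0r.
  pose z := (1 - gamma) * X.
  have z0 : 0 < z by rewrite mulr_gt0 ?subr_gt0// lt_neqAle eq_sym X1.
  have [|||pi [pol V]] := @flow_policy (fun t => x t / z).
  - by have [pi [pol _]] := feasible_ex; exists pi.
  - by move=> t; rewrite divr_ge0// ltW.
  - move=> s; under [in RHS]eq_bigr do rewrite mulrAC.
    rewrite -!mulr_suml; have := flx s; rewrite EE -/X => h.
    rewrite (_ : \sum_a0 _ = z * rho s + gamma * \sum_t x t * P t.1 t.2 s);
      last by rewrite /z; lra.
    by field; rewrite gt_eqF.
  have Vz u : Vrho P rho gamma pi u * z = \sum_t x t * u t.1 t.2.
    rewrite V mulr_suml; apply: eq_bigr => t _.
    by rewrite mulrAC divfK// gt_eqF.
  rewrite -Vz -/z -mulrBl pmulr_lle0// subr_le0 feasible_le_Vstar// => i.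
  by rewrite -(ler_pM2r z0) Vz.
(* Only the constraint multipliers are kept: on an occupancy measure the nonnegativity rows
   contribute at most 0 and the flow rows exactly 0. *)
exists (fun i => mu (inr i)); split => // pi pol.
set x := occupancy pi.
have fx := occupancy_flow pol; have mx := flow_mass fx.
have := gE fs (fun t => r t.1 t.2) x; rewrite -Vrho_occupancy// mx mulr1 => Vr.
rewrite -lerBrDr -lerBlDl -Vr -/g.
under eq_bigr => t _ do rewrite -/(g t) gmu mulr_suml.
rewrite exchange_big /= big_sumType /= -[leRHS]add0r.
rewrite lerD//.
  rewrite big_sumType /= -[leRHS]addr0 lerD//.
    apply: sumr_le0 => t0 _; apply: sumr_le0 => t _.
    by rewrite mulrN mulNr oppr_le0 !mulr_ge0// occupancy_ge0.
  have Ex s : \sum_t E s t * x t = 0.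
    by rewrite EE fx mulrAC mx; ring.
  rewrite big_sumType /= !big1 ?addr0// => s _.
    under eq_bigr do rewrite mulrN mulNr -mulrA; by rewrite sumrN -mulr_sumr Ex mulr0 oppr0.
  under eq_bigr do rewrite -mulrA; by rewrite -mulr_sumr Ex mulr0.
rewrite -sumrN; apply: ler_sum => i _.
under eq_bigr do rewrite -mulrA -opprB mulNr mulrN.
by rewrite sumrN -mulr_sumr gE mx mulr1 -Vrho_occupancy.
Qed.

End Multipliers.
End InitialDistribution.
End Occupancy.

(** * Transfer of the abstract analysis to the CMDP *)

Lemma augL_aug (R : realType) (S A : finType) (P : S -> A -> S -> R) rho gamma r m
    (c : 'I_m -> S -> A -> R) b beta pi lam : 0 < beta ->
  augL P rho gamma r c b beta pi lam =
  aug (fun pi => Vrho P rho gamma pi r)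
      (fun pi i => Vrho P rho gamma pi (c i) - b i) beta pi lam.
Proof.
move=> b0; rewrite /augL /aug mulr_sumr; congr (_ + _); apply: eq_bigr => i _.
rewrite /slack; set v := Vrho _ _ _ _ _ - _.
(* Shifting the minimum by the peak [lam i / beta] exhibits the penalty as a completed square. *)
have -> : Num.min (v - lam i / beta) 0 = Num.min v (lam i / beta) - lam i / beta.
  rewrite -[X in Num.min _ X](subrr (lam i / beta)).
  by rewrite /Num.min ltrD2r; case: ifP.
by field; rewrite gt_eqF.
Qed.

(** The supremum is a genuine upper bound because values of [r] are at most [1 / (1 - gamma)] and
    the negated squares at most 0. *)
Lemma augL_le_augL_max (R : realType) (S A : finType) (P : S -> A -> S -> R) rho gamma
    r m (c : 'I_m -> S -> A -> R) b beta lam pi :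
  is_kernel P -> is_dist rho -> 0 <= gamma < 1 -> (forall s a, r s a <= 1) ->
  0 < beta -> is_policy pi ->
  augL P rho gamma r c b beta pi lam <= augL_max P rho gamma r c b beta lam.
Proof.
move=> kP dr g01 r1 b0 pol; apply: ub_le_sup; last by exists pi.
exists ((1 - gamma)^-1 + beta / 2 * \sum_i lam i ^+ 2 / beta ^+ 2).
move=> _ [q [polq ->]]; apply: lerD; first exact: Vrho_le.
rewrite ler_wpM2l ?divr_ge0 ?(ltW b0)//; apply: ler_sum => i _.
by rewrite gerDr oppr_le0 sqr_ge0.
Qed.

Lemma dual_updateE (R : realType) (S A : finType) (P : S -> A -> S -> R) rho gamma m
    (c : 'I_m -> S -> A -> R) (b : 'I_m -> R) beta lam pi i :
  Vrho P rho gamma pi (c i) - (b i + xi P rho gamma c b beta lam pi i) =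
  slack (fun pi i => Vrho P rho gamma pi (c i) - b i) beta pi lam i.
Proof.
rewrite /xi /slack opprD addrA; set v := _ - b i.
by rewrite /Num.max /Num.min subr_lt0; case: ifP => _; rewrite ?subr0 ?subKr.
Qed.

Unset Implicit Arguments.
Set Strict Implicit.

Theorem theorem1 (R : realType) (S A : finType) (P : S -> A -> S -> R)
  (rho : S -> R) (gamma : R) (r : S -> A -> R) (m : nat)
  (c : 'I_m -> S -> A -> R) (b : 'I_m -> R) :
  is_kernel P -> is_dist rho -> 0 <= gamma < 1 ->
  (forall s a, 0 <= r s a <= 1) ->
  (forall i s a, 0 <= c i s a <= 1) ->
  (forall i, 0 <= b i) ->
  (exists pi, is_policy pi /\ feasible P rho gamma c b pi) ->
  forall beta : R, 0 < beta ->
  forall Ceps : R, 0 <= Ceps ->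
  exists CT : R, 0 < CT /\
  forall eps : R, 0 < eps < 1 ->
  forall T : nat, CT / eps ^+ 2 <= T%:R < CT / eps ^+ 2 + 1 ->
  forall (pi : nat -> S -> A -> R) (lam : nat -> 'I_m -> R),
    is_policy (pi 1%N) ->
    (forall i, lam 1%N i = 0) ->
    (forall t : nat, (1 <= t <= T)%N ->
       is_policy (pi t.+1) /\
       augL P rho gamma r c b beta (pi t.+1) (lam t)
         >= augL_max P rho gamma r c b beta (lam t) - Ceps / (t%:R) ^+ 2 /\
       (forall i, lam t.+1 i =
          lam t i - beta / 2 * (Vrho P rho gamma (pi t.+1) (c i)
                      - (b i + xi P rho gamma c b beta (lam t) (pi t.+1) i)))) ->
    Vrho P rho gamma (pi T.+1) r >= Vstar P rho gamma r c b - eps /\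
    (forall i, Vrho P rho gamma (pi T.+1) (c i) >= b i - eps).
Proof.
move=> kP dr g01 r01 _ _ fex beta b0 Ceps C0.
have r1 s a : r s a <= 1 by case/andP: (r01 s a).
have [mu [mu0 muD]] := lagrange_multipliers kP g01 dr r1 fex.
pose f pi := Vrho P rho gamma pi r.
pose v pi (i : 'I_m) := Vrho P rho gamma pi (c i) - b i.
have mid x y : is_policy x -> is_policy y -> exists z,
    [/\ is_policy z, f z = (f x + f y) / 2 & forall i, v z i = (v x i + v y i) / 2].
  move=> px py; have [z [pz zE]] := Vrho_midpoint kP g01 dr px py.
  by exists z; split => // [|i]; rewrite ?/f ?/v zE//; field.
have least u : (forall y, is_policy y -> (forall i, 0 <= v y i) -> f y <= u) ->
    Vstar P rho gamma r c b <= u.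
  move=> H; apply: (Vstar_le fex) => y py fy; apply: H => // i.
  by rewrite subr_ge0; exact: fy.
(* [CT] is fixed before [eps], [T] and the run are chosen, as the O-notation demands. *)
have [CT [CT0 H]] := iter_complexity b0 mid mu0 muD least C0.
exists CT; split => // eps e01 T /andP[hT _] pi lam _ lam1 step.
have [|fT vT] := H eps T e01 hT pi lam lam1.
  move=> t tT; have [pol [opt upd]] := step t tT; split => //.
    move=> z pz; rewrite -!augL_aug// -lerBlDr; apply: le_trans opt.
    by rewrite lerD2r; exact: augL_le_augL_max.
  by move=> i; rewrite upd dual_updateE.
by split=> // i; have := vT i; rewrite /v; lra.
Qed.
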